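(* Let $D=\{z_i=(x_i,y_i)\}_{i=1}^N$ be a training set for a classification task with $C$ classes, let $z^{(\mathrm{val})}=(x^{(\mathrm{val})},y^{(\mathrm{val})})$ be a validation point, $d(\cdot,\cdot)$ a distance metric, and $\tau$ a threshold. Let $v^{\mathrm{TKNN}}_{z^{(\mathrm{val})}}$ be the Threshold-KNN utility function, and let $\phi^{\mathrm{TKNN}}_{z_i}$ be the Shapley value of $z_i$ in $D$ for this utility. Then for each $z_i\in D$, $$\phi^{\mathrm{TKNN}}_{z_i}=\begin{cases}\mathbf 1[c_\tau\ge 2]\,A_1A_2+\dfrac{\mathbf 1[y_i=y^{(\mathrm{val})}]-1/C}{c_\tau} & \text{if } d(x_i,x^{(\mathrm{val})})\le\tau,\\[2mm] 0 & \text{if } d(x_i,x^{(\mathrm{val})})>\tau,\end{cases}$$ where $$A_1=\frac{\mathbf 1[y_i=y^{(\mathrm{val})}]}{c_\tau}-\frac{c^{(+)}}{c_\tau(c_\tau-1)},\qquad A_2=\sum_{k=0}^{c}\left[\frac1{k+1}-\frac1{k+1}\cdot\frac{\binom{c-k}{c_\tau}}{\binom{c+1}{c_\tau}}\right]-1,$$ and, with $D_{-z_i}=D\setminus\{z_i\}$ and $\mathrm{NB}(S)=\{(x,y)\in S: d(x,x^{(\mathrm{val})})\le\tau\}$, $$c=|D_{-z_i}|,\qquad c_\tau=1+|\mathrm{NB}(D_{-z_i})|,\qquad c^{(+)}=\sum_{(x,y)\in \mathrm{NB}(D_{-z_i})}\mathbf 1[y=y^{(\mathrm{val})}].$$ Moreover: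 (Runtime) all the values $(\phi^{\mathrm{TKNN}}_{z_1},\dots,\phi^{\mathrm{TKNN}}_{z_N})$ can be computed in $O(N)$ time in total. (Full validation set) For a finite validation set $D^{(\mathrm{val})}$ and the utility $v^{\mathrm{TKNN}}_{D^{(\mathrm{val})}}(S)=\sum_{z^{(\mathrm{val})}\in D^{(\mathrm{val})}}v^{\mathrm{TKNN}}_{z^{(\mathrm{val})}}(S)$, the corresponding Shapley values are $$\phi^{\mathrm{TKNN}}_{z_i}\big(v^{\mathrm{TKNN}}_{D^{(\mathrm{val})}}\big)=\sum_{z^{(\mathrm{val})}\in D^{(\mathrm{val})}}\phi^{\mathrm{TKNN}}_{z_i}\big(v^{\mathrm{TKNN}}_{z^{(\mathrm{val})}}\big).$$
   Context: Shapley value: for a utility function $v$ assigning a real number to each subset of a training set $D$ with $|D|=N$, the Shapley value of $z\in D$ is $$\phi_z(D_{-z};v)=\frac1N\sum_{k=1}^{N}\binom{N-1}{k-1}^{-1}\sum_{S\subseteq D_{-z},\,|S|=k-1}\big[v(S\cup\{z\})-v(S)\big],\qquad D_{-z}=D\setminus\{z\}.$$ Training points are regarded as $N$ distinct players (even if two of them coincide as pairs $(x,y)$). Threshold-KNN (TKNN) utility: for $S\subseteq D$ and $\mathrm{NB}(S)=\{(x,y)\in S: d(x,x^{(\mathrm{val})})\le\tau\}$, $$v^{\mathrm{TKNN}}_{z^{(\mathrm{val})}}(S)=\begin{cases}1/C & |\mathrm{NB}(S)|=0,\\ \dfrac1{|\mathrm{NB}(S)|}\displaystyle\sum_{(x,y)\in\mathrm{NB}(S)}\mathbf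 1[y=y^{(\mathrm{val})}] & |\mathrm{NB}(S)|>0.\end{cases}$$ Here $1/C$ is the random-guess accuracy. Conventions: $\binom{a}{b}=0$ for integers $0\le a<b$; the term $\mathbf 1[c_\tau\ge2]A_1A_2$ is $0$ when $c_\tau=1$. In the runtime claim, evaluating one distance, comparing labels, and one arithmetic operation each count as unit cost. *)

(* Defs.v *)
From HB Require Import structures.
From mathcomp Require Import all_boot all_order all_algebra.
From mathcomp Require Import all_classical all_reals all_analysis.

Set Implicit Arguments.
Unset Strict Implicit.
Unset Printing Implicit Defensive.

Import Order.TTheory GRing.Theory Num.Theory.
Local Open Scope ring_scope.

(* The players are the indices 'I_N of the training points, so that two training
   points that coincide as pairs (x, y) remain distinct players; in particular
   the coalition D \ {z_i} is [set~ i]. *)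
Definition shapley (R : realType) (N : nat) (v : {set 'I_N} -> R) (i : 'I_N) : R :=
  N%:R^-1 * \sum_(1 <= k < N.+1) ('C(N.-1, k.-1))%:R^-1 *
    \sum_(S : {set 'I_N} | (S \subset [set~ i]) && (#|S| == k.-1))
      (v (i |: S) - v S).

Definition NB (R : realType) (X : metricType R) (C N : nat)
    (z : 'I_N -> X * 'I_C) (tau : R) (zval : X * 'I_C) (S : {set 'I_N}) : {set 'I_N} :=
  [set j in S | mdist (z j).1 zval.1 <= tau].

Definition tknn (R : realType) (X : metricType R) (C N : nat)
    (z : 'I_N -> X * 'I_C) (tau : R) (zval : X * 'I_C) (S : {set 'I_N}) : R :=
  let B := NB z tau zval S in
  if #|B| == 0%N then C%:R^-1
  else #|B|%:R^-1 * \sum_(j in B) ((z j).2 == zval.2)%:R.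

(* The validation set is a list, hence may have repeated points. *)
Definition tknn_full (R : realType) (X : metricType R) (C N : nat)
    (z : 'I_N -> X * 'I_C) (tau : R) (Dval : seq (X * 'I_C)) (S : {set 'I_N}) : R :=
  \sum_(zval <- Dval) tknn z tau zval S.

Definition c_others (N : nat) (i : 'I_N) : nat := #|[set~ i]|.

Definition c_tau (R : realType) (X : metricType R) (C N : nat)
    (z : 'I_N -> X * 'I_C) (tau : R) (zval : X * 'I_C) (i : 'I_N) : nat :=
  (1 + #|NB z tau zval [set~ i]|)%N.

Definition c_plus (R : realType) (X : metricType R) (C N : nat)
    (z : 'I_N -> X * 'I_C) (tau : R) (zval : X * 'I_C) (i : 'I_N) : nat :=
  (\sum_(j in NB z tau zval [set~ i]) ((z j).2 == zval.2))%N.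

(* For c_tau = 1 the last quotient is a division by zero, equal to 0 by convention;
   A1 is only relevant for c_tau >= 2. *)
Definition A1 (R : realType) (X : metricType R) (C N : nat)
    (z : 'I_N -> X * 'I_C) (tau : R) (zval : X * 'I_C) (i : 'I_N) : R :=
  let ct : R := (c_tau z tau zval i)%:R in
  ((z i).2 == zval.2)%:R / ct - (c_plus z tau zval i)%:R / (ct * (ct - 1)).

Definition A2 (R : realType) (X : metricType R) (C N : nat)
    (z : 'I_N -> X * 'I_C) (tau : R) (zval : X * 'I_C) (i : 'I_N) : R :=
  let c := c_others i in
  let ct := c_tau z tau zval i in
  \sum_(0 <= k < c.+1)
    (k.+1%:R^-1 - k.+1%:R^-1 * ('C(c - k, ct)%:R / 'C(c.+1, ct)%:R)) - 1.

(* A program is a finite piece of syntax that does not mention the input, so one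
   and the same program has to handle all N. It works with real registers, index
   registers (natural numbers, which can only be reset, incremented, compared and
   loaded with N) and a real-valued memory m, all addressed by natural numbers.
   The training points and the validation point are accessible only through
   IDist (one distance evaluation) and TLabel (one label comparison). *)

Inductive binop := OpAdd | OpSub | OpMul | OpDiv.

Inductive instr :=
  | RConst of nat & nat                 (* r[a] := n *)
  | RTau of nat                         (* r[a] := tau *)
  | RClasses of nat                     (* r[a] := C *)
  | ROp of binop & nat & nat & nat      (* r[a] := r[b] op r[c] *)
  | IDist of nat & nat                  (* r[a] := d(x_(i[b]), xval) *)
  | RLoad of nat & nat                  (* r[a] := m[i[b]] *)
  | RStore of nat & nat                 (* m[i[a]] := r[b] *)
  | IZero of nat                        (* i[a] := 0 *)
  | ISucc of nat                        (* i[a] := i[a] + 1 *)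
  | ISize of nat.                       (* i[a] := N *)

Inductive test :=
  | TRealLe of nat & nat                (* r[a] <= r[b] *)
  | TIdxLt of nat & nat                 (* i[a] < i[b] *)
  | TLabel of nat.                      (* y_(i[a]) = yval *)

Inductive prog :=
  | Do of instr
  | Seq of prog & prog
  | If of test & prog & prog
  | While of test & prog.

Record mstate (R : realType) := MState {
  rreg : nat -> R;
  ireg : nat -> nat;
  memory : nat -> R
}.

Definition mstate0 (R : realType) : mstate R :=
  MState (fun=> 0) (fun=> 0%N) (fun=> 0).

Definition set_rreg (R : realType) (s : mstate R) (a : nat) (x : R) : mstate R :=
  MState [eta rreg s with a |-> x] (ireg s) (memory s).
Definition set_ireg (R : realType) (s : mstate R) (a : nat) (n : nat) : mstate R :=
  MState (rreg s) [eta ireg s with a |-> n] (memory s).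
Definition set_memory (R : realType) (s : mstate R) (a : nat) (x : R) : mstate R :=
  MState (rreg s) (ireg s) [eta memory s with a |-> x].

(* None means that the machine is stuck: division by zero, or access to a
   training point whose index is not < N. *)
Definition binop_sem (R : realType) (o : binop) (x y : R) : option R :=
  match o with
  | OpAdd => Some (x + y)
  | OpSub => Some (x - y)
  | OpMul => Some (x * y)
  | OpDiv => if y == 0 then None else Some (x / y)
  end.

Definition instr_sem (R : realType) (X : metricType R) (C N : nat)
    (z : 'I_N -> X * 'I_C) (tau : R) (zval : X * 'I_C)
    (c : instr) (s : mstate R) : option (mstate R) :=
  match c with
  | RConst a n => Some (set_rreg s a n%:R)
  | RTau a => Some (set_rreg s a tau)
  | RClasses a => Some (set_rreg s a C%:R)
  | ROp o a b b' => omap (set_rreg s a) (binop_sem o (rreg s b) (rreg s b'))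
  | IDist a b =>
      omap (fun j : 'I_N => set_rreg s a (mdist (z j).1 zval.1)) (insub (ireg s b))
  | RLoad a b => Some (set_rreg s a (memory s (ireg s b)))
  | RStore a b => Some (set_memory s (ireg s a) (rreg s b))
  | IZero a => Some (set_ireg s a 0)
  | ISucc a => Some (set_ireg s a (ireg s a).+1)
  | ISize a => Some (set_ireg s a N)
  end.

Definition test_sem (R : realType) (X : metricType R) (C N : nat)
    (z : 'I_N -> X * 'I_C) (zval : X * 'I_C)
    (b : test) (s : mstate R) : option bool :=
  match b with
  | TRealLe a b => Some (rreg s a <= rreg s b)
  | TIdxLt a b => Some (ireg s a < ireg s b)%N
  | TLabel a => omap (fun j : 'I_N => (z j).2 == zval.2) (insub (ireg s a))
  end.

(* exec z tau zval p s t s' : started in state s, the program p terminates in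
   state s' after t unit-cost operations; every instruction and every evaluation
   of a test costs 1. *)
Inductive exec (R : realType) (X : metricType R) (C N : nat)
    (z : 'I_N -> X * 'I_C) (tau : R) (zval : X * 'I_C) :
    prog -> mstate R -> nat -> mstate R -> Prop :=
  | ExecDo c s s' :
      instr_sem z tau zval c s = Some s' ->
      exec z tau zval (Do c) s 1 s'
  | ExecSeq p q s s1 s2 t1 t2 :
      exec z tau zval p s t1 s1 -> exec z tau zval q s1 t2 s2 ->
      exec z tau zval (Seq p q) s (t1 + t2) s2
  | ExecIfTrue b p q s s' t :
      test_sem z zval b s = Some true -> exec z tau zval p s t s' ->
      exec z tau zval (If b p q) s t.+1 s'
  | ExecIfFalse b p q s s' t :
      test_sem z zval b s = Some false -> exec z tau zval q s t s' ->
      exec z tau zval (If b p q) s t.+1 s'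
  | ExecWhileTrue b p s s1 s2 t1 t2 :
      test_sem z zval b s = Some true -> exec z tau zval p s t1 s1 ->
      exec z tau zval (While b p) s1 t2 s2 ->
      exec z tau zval (While b p) s (t1 + t2).+1 s2
  | ExecWhileFalse b p s :
      test_sem z zval b s = Some false ->
      exec z tau zval (While b p) s 1 s.

(* p outputs the values f 0, ..., f (N - 1) in the first N memory cells, after at
   most T operations. *)
Definition computes_within (R : realType) (X : metricType R) (C N : nat)
    (z : 'I_N -> X * 'I_C) (tau : R) (zval : X * 'I_C)
    (p : prog) (T : nat) (f : 'I_N -> R) : Prop :=
  exists (t : nat) (s : mstate R),
    [/\ exec z tau zval p (mstate0 R) t s, (t <= T)%N &
        forall i : 'I_N, memory s i = f i].

(* Main.v *)
Require Import Defs.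
From mathcomp Require Import all_boot all_order all_algebra.
From mathcomp Require Import all_classical all_reals all_analysis.
From mathcomp Require Import ring zify.

Set Implicit Arguments.
Unset Strict Implicit.
Unset Printing Implicit Defensive.

Import boot.finset Order.TTheory GRing.Theory Num.Theory.

Local Open Scope ring_scope.

(** The marginal contribution of a point depends only on the neighbours already
    present, and points that are not neighbours are null players. Removing null
    players one at a time does not change the Shapley weights, because
    [w(n+1, s) + w(n+1, s+1) = w(n, s)], so the sum may be taken over coalitions
    of neighbours only. Grouping these by size gives a closed form containing the
    harmonic sum [H_m] of the number [m] of neighbours, and [A2 = H_m - 1] by
    induction on [m].
    For the running time, the closed form depends on the point only through its
    label and whether it is a neighbour: one pass computes [m], [H_m] and the
    number of correctly labelled neighbours, a second pass writes the values. *)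

(** * Shapley weights and weighted sums over coalitions *)

Section ShapleyWeights.
Variable R : realType.
Implicit Types (n s m : nat).

(** Here [n] counts the other players, so the game has [n.+1] players and [s] is the size of the
    coalition being joined. *)
Definition weight n s : R := n.+1%:R^-1 * 'C(n, s)%:R^-1.

(** Over the common denominator [n.+1 * 'C(n, s)] the two inverse binomials have numerators
    [n.+1 - s] and [s.+1]; their sum [n.+2] cancels the prefactor. *)
Lemma weight_recurrence n s : (s <= n)%N ->
  weight n.+1 s + weight n.+1 s.+1 = weight n s.
Proof.
move=> le_sn; rewrite /weight.
have Cs : (n.+1 - s)%:R * 'C(n.+1, s)%:R = n.+1%:R * 'C(n, s)%:R :> R.
  by rewrite -!natrM mul_bin_down.
have CS : s.+1%:R * 'C(n.+1, s.+1)%:R = n.+1%:R * 'C(n, s)%:R :> R.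
  by rewrite -!natrM mul_bin_diag.
have nz m : (0 < m)%N -> m%:R != 0 :> R by rewrite pnatr_eq0 -lt0n.
have b0 : 'C(n, s)%:R != 0 :> R by rewrite nz ?bin_gt0.
have b1 : 'C(n.+1, s)%:R != 0 :> R by rewrite nz ?bin_gt0 ?leqW.
have b2 : 'C(n.+1, s.+1)%:R != 0 :> R by rewrite nz ?bin_gt0.
have -> : 'C(n.+1, s)%:R^-1 = (n.+1 - s)%:R / (n.+1%:R * 'C(n, s)%:R) :> R.
  by rewrite -Cs; field; rewrite b1 nz // subn_gt0.
have -> : 'C(n.+1, s.+1)%:R^-1 = s.+1%:R / (n.+1%:R * 'C(n, s)%:R) :> R.
  by rewrite -CS; field; rewrite b2 nat1r nz.
rewrite natrB ?leqW //; field.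
by rewrite b0 -natrD nat1r !nz.
Qed.

Lemma sum_subset_split (I : finType) (A : {set I}) (j : I) (F : {set I} -> R) :
  j \in A ->
  \sum_(S : {set I} | S \subset A) F S =
  \sum_(S : {set I} | S \subset A :\ j) (F S + F (j |: S)).
Proof.
move=> jA; rewrite (bigID (fun S : {set I} => j \in S)) /= addrC big_split /=.
congr (_ + _); first by apply: eq_bigl => S; rewrite subsetD1.
rewrite (reindex_onto (fun S => j |: S) (fun S => S :\ j)) /=; last first.
  by move=> S /andP[_ jS]; rewrite setD1K.
apply: eq_bigl => S; rewrite subUset sub1set jA setU11 andbT /= subsetD1.
congr (_ && _); apply/eqP/idP => [<-|jS]; first by rewrite !inE eqxx.
by rewrite setU1K.
Qed.

(* Players outside [B] are null for [h]: removing them one at a time preserves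
   the weighted sum. *)
Lemma sum_weight_setI (I : finType) (A B : {set I}) (h : {set I} -> R) :
  B \subset A ->
  \sum_(S : {set I} | S \subset A) weight #|A| #|S| * h (S :&: B) =
  \sum_(S : {set I} | S \subset B) weight #|B| #|S| * h S.
Proof.
have [n] := ubnP #|A :\: B|; elim: n A => // n IHn A ltAn sBA.
have [AB0|[j]] := set_0Vmem (A :\: B).
  have -> : A = B by apply/eqP; rewrite eqEsubset sBA andbT -setD_eq0 AB0.
  by apply: eq_bigr => S /setIidPl ->.
rewrite inE => /andP[jB jA].
have sBAj : B \subset A :\ j by rewrite subsetD1 sBA.
rewrite (sum_subset_split _ jA) -(IHn (A :\ j)) //; last first.
  apply: (leq_trans (proper_card _) (ltAn : #|A :\: B| <= n)%N).
  apply/properP; split; first by apply: setSD; apply: subsetDl.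
  by exists j; rewrite !inE ?eqxx ?jB.
have cA : #|A| = #|A :\ j|.+1 by rewrite (cardsD1 j A) jA.
apply: eq_bigr => S; rewrite subsetD1 => /andP[sSA jS].
(* [S] and [j |: S] have the same trace on [B], so their two weights merge by the recurrence. *)
have -> : (j |: S) :&: B = S :&: B.
  by apply/setP=> x; rewrite !inE; case: eqP => // ->; rewrite (negPf jB) !andbF.
rewrite cardsU1 jS add1n cA -mulrDl weight_recurrence //.
by apply: subset_leq_card; rewrite subsetD1 sSA.
Qed.

Lemma sum_subset_card (I : finType) (A : {set I}) (F : nat -> R) :
  \sum_(S : {set I} | S \subset A) F #|S| =
  \sum_(s < #|A|.+1) 'C(#|A|, s)%:R * F s.
Proof.
rewrite (partition_big (fun S : {set I} => inord #|S| : 'I_(#|A|.+1)) xpredT) //=.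
apply: eq_bigr => s _; rewrite -cards_draws mulr_natl -sumr_const.
apply: eq_big => [S|S /andP[sSA /eqP <-]]; last first.
  by rewrite inordK // ltnS subset_leq_card.
rewrite inE; case: (boolP (S \subset A)) => //= sSA.
by rewrite -val_eqE /= inordK // ltnS subset_leq_card.
Qed.

(** The number of subsets of a given size cancels the binomial in the weight, so all sizes get the
    same total weight. *)
Lemma sum_weight_card (I : finType) (A : {set I}) (f : nat -> R) :
  \sum_(S : {set I} | S \subset A) weight #|A| #|S| * f #|S| =
  #|A|.+1%:R^-1 * \sum_(s < #|A|.+1) f s.
Proof.
rewrite (sum_subset_card _ (fun s => weight #|A| s * f s)) mulr_sumr.
apply: eq_bigr => s _; rewrite /weight; field.
by rewrite pnatr_eq0 -lt0n bin_gt0 -ltnS ltn_ord nat1r pnatr_eq0.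
Qed.

(** After exchanging the sums, each [j] in [A] lies in a fraction [s / #|A|] of the subsets of size
    [s]. *)
Lemma sum_weight_card_mem (I : finType) (A : {set I}) (f : nat -> R)
    (q : I -> R) :
  \sum_(S : {set I} | S \subset A)
    weight #|A| #|S| * (f #|S| * \sum_(j in S) q j) =
  (\sum_(j in A) q j) * (#|A|.+1%:R^-1 *
    \sum_(s < #|A|.+1) f s * (s%:R / #|A|%:R)).
Proof.
transitivity (\sum_(j in A) q j *
    \sum_(S : {set I} | (S \subset A) && (j \in S)) weight #|A| #|S| * f #|S|).
  under eq_bigr do rewrite mulrA mulr_sumr.
  rewrite (exchange_big_dep (fun j => j \in A)) /=; last first.
    by move=> S j /fintype.subsetP; apply.
  by apply: eq_bigr => j _; rewrite mulr_sumr; apply: eq_bigr => S _; rewrite mulrC.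
rewrite mulr_suml; apply: eq_bigr => j jA; congr (_ * _).
pose F s := weight #|A| s * f s.
have cA : #|A| = #|A :\ j|.+1 by rewrite (cardsD1 j A) jA.
have E : \sum_(S : {set I} | (S \subset A) && (j \in S)) F #|S| =
    \sum_(S : {set I} | S \subset A) F #|S| -
    \sum_(S : {set I} | S \subset A :\ j) F #|S|.
  rewrite [X in X - _](bigID (fun S : {set I} => j \in S)) /=.
  rewrite [X in _ + X - _](eq_bigl (fun S : {set I} => S \subset A :\ j)) ?addrK //.
  by move=> S; rewrite subsetD1.
rewrite -/F E !sum_subset_card cA big_ord_recr [in X in X - _ = _]/=.
rewrite -addrAC -sumrB mulr_sumr [RHS]big_ord_recr /= addrC [RHS]addrC.
rewrite /F cA /weight.
set b := #|A :\ j|; have bn0 m : m.+1%:R != 0 :> R by rewrite pnatr_eq0.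
congr (_ + _).
  by rewrite binn divff ?bn0 // invr1; ring.
apply: eq_bigr => s _.
have Hs : (s <= b)%N by rewrite -ltnS.
have C0 : 'C(b.+1, s)%:R != 0 :> R by rewrite pnatr_eq0 -lt0n bin_gt0 leqW.
(* Hence ['C(b.+1, s) - 'C(b, s)], the number of subsets of size [s] containing [j], is [s / b.+1]
   times ['C(b.+1, s)]. *)
have -> : 'C(b, s)%:R = (b.+1%:R - s%:R) * 'C(b.+1, s)%:R / b.+1%:R :> R.
  by rewrite -natrB ?leqW // -natrM -mul_bin_down natrM mulrC mulKf.
 field.
by rewrite C0 -natrD nat1r !bn0.
Qed.

End ShapleyWeights.

(** * Closed form of the Shapley value through harmonic sums *)

Section ShapleyFormula.
Variable R : realType.

(** Each coalition [S] occurs only for [k = #|S|.+1], so the double sum collapses to one sum over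
    coalitions. *)
Lemma shapleyE N (v : {set 'I_N} -> R) (i : 'I_N) :
  shapley v i =
  \sum_(S : {set 'I_N} | S \subset [set~ i])
    weight R #|[set~ i]| #|S| * (v (i |: S) - v S).
Proof.
have cN : N = #|[set~ i]|.+1.
  by rewrite cardsC1 card_ord prednK // (leq_trans _ (ltn_ord i)).
rewrite /shapley big_add1 big_mkord mulr_sumr.
under eq_bigr => k _ do rewrite /= big_distrr /= big_distrr /=.
rewrite (exchange_big_dep (fun S : {set 'I_N} => S \subset [set~ i])) /=; last first.
  by move=> k S _ /andP[].
apply: eq_bigr => S sS.
have ltSN : (#|S| < N)%N by rewrite [N in (_ < N)%N]cN ltnS subset_leq_card.
rewrite (big_pred1 (Ordinal ltSN)) /=; last first.
  by move=> k /=; rewrite sS -val_eqE /= eq_sym.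
have cN1 : N.-1 = #|[set~ i]| by apply: succn_inj; rewrite -cN prednK // cN.
by rewrite mulrA /weight -cN cN1.
Qed.

Definition harmonic_sum (m : nat) : R := \sum_(j < m) j.+1%:R^-1.

Lemma hockey_stick N m : (\sum_(j < N) 'C(j, m))%N = 'C(N, m.+1).
Proof.
by elim: N => [|N IHN]; rewrite ?big_ord0 // big_ord_recr /= IHN binS addnC.
Qed.

(* Passing from [m] to [m.+1] lowers the sum of the second terms by exactly
   [m.+1%:R^-1], by the hockey-stick identity. *)
Lemma harmonic_sum_bin N m : (m <= N)%N ->
  \sum_(k < N) (k.+1%:R^-1 -
     k.+1%:R^-1 * ('C(N.-1 - k, m)%:R / 'C(N, m)%:R)) = harmonic_sum m.
Proof.
elim: m => [|m IHm] lemN.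
  rewrite /harmonic_sum big_ord0 big1 // => k _.
  by rewrite !bin0 divr1 mulr1 subrr.
rewrite /harmonic_sum big_ord_recr /= -/(harmonic_sum m) -IHm; last exact: ltnW.
apply/eqP; rewrite -subr_eq0 opprD addrA subr_eq0; apply/eqP.
have CNm : 'C(N, m)%:R != 0 :> R by rewrite pnatr_eq0 -lt0n bin_gt0 ltnW.
have CNm1 : 'C(N, m.+1)%:R != 0 :> R by rewrite pnatr_eq0 -lt0n bin_gt0.
have mS : m.+1%:R != 0 :> R by rewrite pnatr_eq0.
have NmE : m.+1%:R * 'C(N, m.+1)%:R = (N%:R - m%:R) * 'C(N, m)%:R :> R.
  by rewrite -natrB ?(ltnW lemN) // -!natrM mul_bin_left.
have Nm0 : N%:R - m%:R != 0 :> R by rewrite subr_eq0 eqr_nat gtn_eqF.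
rewrite -sumrB.
(* The difference of the two binomial ratios carries a factor [k.+1], which cancels [k.+1%:R^-1]. *)
transitivity (\sum_(k < N) ('C(N.-1 - k, m)%:R * (m.+1%:R * 'C(N, m.+1)%:R)^-1 : R)).
  apply: eq_bigr => k _.
  have ltkN := ltn_ord k.
  have k1 : k.+1%:R != 0 :> R by rewrite pnatr_eq0.
  have -> : 'C(N.-1 - k, m.+1)%:R =
      (N%:R - k.+1%:R - m%:R) * 'C(N.-1 - k, m)%:R / m.+1%:R :> R.
    have -> : (N.-1 - k = N - k.+1)%N by lia.
    (* For [m] beyond [N - k.+1] the real factor is negative rather than truncated, but both
       binomials vanish. *)
    have [lem|ltm] := leqP m (N - k.+1).
      rewrite -!natrB // -natrM -mul_bin_left natrM mulrC mulKf //.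
    by rewrite !bin_small ?mulr0 ?mul0r // ltnW.
  have -> : 'C(N, m)%:R = m.+1%:R * 'C(N, m.+1)%:R / (N%:R - m%:R) :> R.
    by rewrite NmE mulrC mulKf.
  by field; rewrite CNm1 nat1r mS nat1r k1 Nm0.
rewrite -mulr_suml (reindex_inj rev_ord_inj) /=.
under eq_bigr => k _.
  have -> : (N.-1 - (N - k.+1) = k)%N by have := ltn_ord k; lia.
  over.
by rewrite -natr_sum hockey_stick invfM mulrC mulfVK.
Qed.

Variables (X : metricType R) (C N : nat).
Variables (z : 'I_N -> X * 'I_C) (tau : R) (zval : X * 'I_C).

Definition is_near (i : 'I_N) := mdist (z i).1 zval.1 <= tau.
Definition correct (i : 'I_N) := (z i).2 == zval.2.
Definition utility_near (B : {set 'I_N}) : R :=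
  if #|B| == 0%N then C%:R^-1 else #|B|%:R^-1 * \sum_(j in B) (correct j)%:R.

Lemma tknnE S : tknn z tau zval S = utility_near (NB z tau zval S).
Proof. by []. Qed.

Lemma NB_setU1 i S :
  NB z tau zval (i |: S) =
  if is_near i then i |: NB z tau zval S else NB z tau zval S.
Proof.
rewrite /is_near; case: ifP => di; apply/setP => j; rewrite !inE andb_orl //.
  by case: (eqVneq j i) => [->|//]; rewrite di.
by case: (eqVneq j i) => [->|//]; rewrite di !andbF.
Qed.

Lemma NB_setI (A S : {set 'I_N}) : S \subset A ->
  NB z tau zval S = S :&: NB z tau zval A.
Proof.
move/fintype.subsetP => sSA; apply/setP => j; rewrite !inE.
by case: (boolP (j \in S)) => // /sSA ->.
Qed.

(* The value depends on the point only through its label; this is what the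
   program evaluates. *)
Definition tknn_value (m P : nat) (y : bool) : R :=
  (if (m <= 1)%N then 0
   else (y%:R - (P%:R - y%:R) / (m%:R - 1)) * (harmonic_sum m - 1) / m%:R)
  + (y%:R - C%:R^-1) / m%:R.

Lemma shapley_far i : ~~ is_near i -> shapley (tknn z tau zval) i = 0.
Proof.
move=> far; rewrite shapleyE big1 // => S _.
by rewrite !tknnE NB_setU1 (negPf far) subrr mulr0.
Qed.

(** If a coalition has [s > 0] neighbours, [p] of them correct, then adding [i] moves the mean from
    [p/s] to [(p+y)/(s+1)], a change of [y/(s+1) - p/(s(s+1))]. The two terms are averaged
    separately. *)
Lemma shapley_near i : is_near i ->
  shapley (tknn z tau zval) i =
  let B := NB z tau zval [set~ i] in
  tknn_value #|B|.+1 (correct i + \sum_(j in B) correct j) (correct i).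
Proof.
move=> neari /=; rewrite shapleyE; set B := NB _ _ _ [set~ i].
have sB : B \subset [set~ i] by apply/fintype.subsetP => j; rewrite inE => /andP[].
pose y : R := (correct i)%:R.
pose q (j : 'I_N) : R := (correct j)%:R.
(* Size 0 is special because the empty neighbourhood is worth [1/C]; there [f2] multiplies an empty
   sum. *)
pose f1 (s : nat) : R := if s is 0 then y - C%:R^-1 else y / s.+1%:R.
pose f2 (s : nat) : R := (s%:R * s.+1%:R)^-1.
transitivity (\sum_(S : {set 'I_N} | S \subset [set~ i])
    weight R #|[set~ i]| #|S| *
    (f1 #|S :&: B| - f2 #|S :&: B| * \sum_(j in S :&: B) q j)).
  apply: eq_bigr => S sS; congr (_ * _).
  rewrite !tknnE NB_setU1 neari (NB_setI sS) -/B; set T := S :&: B.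
  have iT : i \notin T.
    apply/negP => /setIP[iS _]; have := fintype.subsetP sS i iS.
    by rewrite !inE eqxx.
  rewrite /utility_near cardsU1 iT add1n /= big_setU1 //= -/(q _) -/y.
  have [T0|T0] := eqVneq #|T| 0%N.
    by rewrite T0 (cards0_eq T0) big_set0 invr1 addr0 mulr0 mul1r subr0.
  have -> : f1 #|T| = y / #|T|.+1%:R by rewrite /f1; case: #|T| T0.
  rewrite /f2 -/(\sum_(j in T) q j); field.
  by rewrite nat1r !pnatr_eq0 T0.
rewrite (sum_weight_setI (fun T => f1 #|T| - f2 #|T| * \sum_(j in T) q j) sB).
rewrite (eq_bigr _ (fun S _ => mulrBr _ _ _)).
rewrite sumrB (sum_weight_card _ f1) (sum_weight_card_mem _ f2).
rewrite /tknn_value; set b := #|B|.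
rewrite natrD -/y addrAC subrr add0r natr_sum -/(\sum_(j in B) q j).
set p := \sum_(j in B) q j.
(* Peeling off index 0 isolates the [1/C] term and turns [H_m - 1] into the tail that the [f1] and
   [f2] sums also produce. *)
rewrite /harmonic_sum big_ord_recl (big_ord_recl b) (big_ord_recl b) /=.
rewrite invr1 [1 + _]addrC addrK.
under [\sum_(s < b) (y / _)]eq_bigr do rewrite -[bump 0 _]/(_.+1).
rewrite -mulr_sumr.
have b1 : b.+1%:R != 0 :> R by rewrite pnatr_eq0.
rewrite mul0r mulr0 add0r.
have [b0|bpos] := posnP b.
  by rewrite !b0 !big_ord0 /= !(mulr0, subr0, addr0, add0r, invr1, mul1r, mulr1).
have bn : b%:R != 0 :> R by rewrite pnatr_eq0 -lt0n.
have -> : \sum_(s < b) f2 (bump 0 s) * ((bump 0 s)%:R / b%:R) =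
    (\sum_(s < b) (bump 0 s).+1%:R^-1) / b%:R.
  rewrite mulr_suml; apply: eq_bigr => s _; rewrite /f2 -[bump 0 s]/(s.+1); field.
  by rewrite bn -natrD nat1r !pnatr_eq0.
rewrite ifF; last by rewrite -ltnS; case: (b) bpos.
rewrite -[b.+1%:R]natr1 addrK; set Cinv := C%:R^-1; field.
by rewrite bn natr1 b1.
Qed.

End ShapleyFormula.

(** * Program logic with a time bound *)

Section Cost.

(* A loop is assumed to run at most [N] times. *)
Fixpoint cost (N : nat) (p : prog) : nat :=
  match p with
  | Do _ => 1
  | Seq p q => cost N p + cost N q
  | If _ p q => (maxn (cost N p) (cost N q)).+1
  | While _ p => (N * (cost N p).+1).+1
  end.

Variables (R : realType) (X : metricType R) (C N : nat).
Variables (z : 'I_N -> X * 'I_C) (tau : R) (zval : X * 'I_C).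

(** A weakest precondition for total correctness that carries the time bound, so one walk through a
    program proves both. *)
Definition wp (p : prog) (Q : mstate R -> Prop) (s : mstate R) : Prop :=
  exists t s', [/\ exec z tau zval p s t s', (t <= cost N p)%N & Q s'].

Lemma wp_do c Q s :
  (if instr_sem z tau zval c s is Some s' then Q s' else False) ->
  wp (Do c) Q s.
Proof.
case E: (instr_sem _ _ _ c s) => [s'|//] Qs'.
by exists 1%N, s'; split => //; apply: ExecDo.
Qed.

Lemma wp_seq p q Q s : wp p (wp q Q) s -> wp (Seq p q) Q s.
Proof.
move=> [t1 [s1 [e1 le1 [t2 [s2 [e2 le2 Qs2]]]]]].
by exists (t1 + t2)%N, s2; split; [apply: ExecSeq e1 e2|apply: leq_add|].
Qed.

Lemma wp_if b v p q Q s : test_sem z zval b s = Some v ->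
  wp (if v then p else q) Q s -> wp (If b p q) Q s.
Proof.
case: v => Eb [t [s' [e le_t Qs']]]; exists t.+1, s'; split => //=.
- exact: ExecIfTrue.
- by rewrite ltnS leq_max le_t.
- exact: ExecIfFalse.
- by rewrite ltnS leq_max le_t orbT.
Qed.

(** The invariant ties the counter to the iteration number and the limit to [N], which justifies the
    loop bound assumed in [cost]. *)
Lemma wp_for (Inv : nat -> mstate R -> Prop) a b p Q s :
  (forall k s1, Inv k s1 -> ireg s1 a = k /\ ireg s1 b = N) ->
  (forall (k : 'I_N) s1, Inv k s1 -> wp p (Inv k.+1) s1) ->
  (forall s1, Inv N s1 -> Q s1) ->
  Inv 0%N s -> wp (While (TIdxLt a b) p) Q s.
Proof.
move=> Iab Ip IQ I0.
(* Induction on the number [d] of remaining iterations; the extra unit pays for the final failing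
   test. *)
suff H d k s1 : (k + d = N)%N -> Inv k s1 -> exists t s',
    [/\ exec z tau zval (While (TIdxLt a b) p) s1 t s',
        (t <= (d * (cost N p).+1).+1)%N & Q s'].
  exact: (H N 0%N).
elim: d k s1 => [|d IHd] k s1.
  rewrite addn0 => -> IN; exists 1%N, s1; split => //; last exact: IQ.
  by apply: ExecWhileFalse; have [/= -> ->] := Iab _ _ IN; rewrite ltnn.
move=> kdN Ik; have ltkN : (k < N)%N by rewrite -kdN addnS ltnS leq_addr.
have [t1 [s2 [e1 le1 I2]]] := Ip (Ordinal ltkN) s1 Ik.
have [|t2 [s3 [e2 le2 Qs3]]] := IHd k.+1 s2 _ I2; first by rewrite addSnnS.
exists (t1 + t2).+1, s3; split => //.
  by apply: ExecWhileTrue e1 e2; have [/= -> ->] := Iab _ _ Ik; rewrite ltkN.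
by rewrite ltnS mulSn addSn -addnS leq_add.
Qed.

Lemma wp_dist a b (j : 'I_N) (Q : mstate R -> Prop) s : ireg s b = j ->
  Q (set_rreg s a (mdist (z j).1 zval.1)) -> wp (Do (IDist a b)) Q s.
Proof. by move=> sb Qs; apply: wp_do => /=; rewrite sb valK. Qed.

Lemma wp_label a (j : 'I_N) p q Q s : ireg s a = j ->
  wp (if correct z zval j then p else q) Q s -> wp (If (TLabel a) p q) Q s.
Proof. by move=> sa; apply: wp_if => /=; rewrite sa valK. Qed.

Lemma wp_div a b c (Q : mstate R -> Prop) s : rreg s c != 0 ->
  Q (set_rreg s a (rreg s b / rreg s c)) -> wp (Do (ROp OpDiv a b c)) Q s.
Proof. by move=> c0 Qs; apply: wp_do => /=; rewrite (negPf c0). Qed.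

End Cost.

(* The linear-time program *)
Local Infix ";;" := Seq (at level 60, right associativity).

(* Index registers: 0 is the loop counter, 1 holds N. Real registers: 0 tau,
   1 the constant 1, 2 the number m of neighbours, 3 the harmonic sum H_m,
   4 the number of correctly labelled neighbours, 5 scratch. *)
Definition count_body : prog :=
  Do (IDist 5 0) ;;
  If (TRealLe 5 0)
    (Do (ROp OpAdd 2 2 1) ;;
     Do (ROp OpDiv 5 1 2) ;;
     Do (ROp OpAdd 3 3 5) ;;
     (* With no skip instruction, resetting scratch register 5 plays the empty branch. *)
     If (TLabel 0) (Do (ROp OpAdd 4 4 1)) (Do (RConst 5 0)))
    (Do (RConst 5 0)) ;;
  Do (ISucc 0).

(* Now register 3 holds H_m - 1 and register 7 holds 1/C; the value is built up
   in register 6. *)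
Definition output_body : prog :=
  Do (IDist 5 0) ;;
  If (TRealLe 5 0)
    (If (TLabel 0) (Do (RConst 6 1)) (Do (RConst 6 0)) ;;
     Do (ROp OpSub 8 6 7) ;;
     Do (ROp OpDiv 8 8 2) ;;
     Do (ROp OpSub 9 4 6) ;;
     Do (ROp OpSub 10 2 1) ;;
     (* This guard avoids a division by [m - 1 = 0]. *)
     If (TRealLe 2 1)
       (Do (RConst 6 0))
       (Do (ROp OpDiv 9 9 10) ;;
        Do (ROp OpSub 6 6 9) ;;
        Do (ROp OpMul 6 6 3) ;;
        Do (ROp OpDiv 6 6 2)) ;;
     Do (ROp OpAdd 6 6 8))
    (Do (RConst 6 0)) ;;
  Do (RStore 0 6) ;;
  Do (ISucc 0).

(** The first loop relies on the counter and the accumulators being 0 in the initial state. *)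
Definition tknn_prog : prog :=
  Do (ISize 1) ;;
  Do (RTau 0) ;;
  Do (RConst 1 1) ;;
  While (TIdxLt 0 1) count_body ;;
  Do (ROp OpSub 3 3 1) ;;
  Do (RClasses 7) ;;
  Do (ROp OpDiv 7 1 7) ;;
  Do (IZero 0) ;;
  While (TIdxLt 0 1) output_body.

(** * Correctness of the program *)

Section Correctness.
Variables (R : realType) (X : metricType R) (C N : nat).
Variables (z : 'I_N -> X * 'I_C) (tau : R) (zval : X * 'I_C).

Local Notation wp := (wp z tau zval).
Local Notation is_near := (is_near z tau zval).
Local Notation correct := (correct z zval).

Definition near_count (k : nat) : nat := \sum_(j < N | (j < k)%N) is_near j.
Definition correct_count (k : nat) : nat :=
  \sum_(j < N | (j < k)%N) (is_near j && correct j).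

Lemma sum_ord_ltnS (F : 'I_N -> nat) (k : 'I_N) :
  (\sum_(j < N | (j < k.+1)%N) F j = F k + \sum_(j < N | (j < k)%N) F j)%N.
Proof.
rewrite (bigD1 k) //=; congr (_ + _)%N; apply: eq_bigl => j.
by rewrite ltnS ltn_neqAle andbC.
Qed.

Lemma near_countS (k : 'I_N) : near_count k.+1 = (is_near k + near_count k)%N.
Proof. exact: sum_ord_ltnS. Qed.

Lemma correct_countS (k : 'I_N) :
  correct_count k.+1 = ((is_near k && correct k) + correct_count k)%N.
Proof. exact: sum_ord_ltnS. Qed.

Record count_inv (k : nat) (s : mstate R) : Prop := CountInv {
  count_i0 : ireg s 0 = k;
  count_i1 : ireg s 1 = N;
  count_r0 : rreg s 0 = tau;
  count_r1 : rreg s 1 = 1;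
  count_r2 : rreg s 2 = (near_count k)%:R;
  count_r3 : rreg s 3 = harmonic_sum R (near_count k);
  count_r4 : rreg s 4 = (correct_count k)%:R
}.

Lemma count_bodyP (k : 'I_N) s :
  count_inv k s -> wp count_body (count_inv k.+1) s.
Proof.
move=> [i0 i1 r0 r1 r2 r3 r4].
have nS : near_count k.+1 = (is_near k + near_count k)%N := near_countS k.
have cS := correct_countS k.
apply: wp_seq; apply: (@wp_dist _ _ _ _ _ _ _ _ _ k); first exact: i0.
apply: wp_seq.
apply: (@wp_if _ _ _ _ _ _ _ _ (is_near k)); first by rewrite /= r0.
case: (is_near k) nS cS => /= nS cS; last first.
  by do 2!apply: wp_do => /=; split; rewrite //= ?nS ?cS // i0.
(* The count is incremented before dividing, so the divisor is a successor and the quotient is the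
   next harmonic term. *)
apply: wp_seq; apply: wp_do => /=; apply: wp_seq; apply: wp_div => /=.
  by rewrite r1 r2 natr1 pnatr_eq0.
apply: wp_seq; apply: wp_do => /=.
apply: (@wp_label _ _ _ _ _ _ _ _ k); first exact: i0.
have hS : harmonic_sum R (near_count k) + (near_count k).+1%:R^-1 =
    harmonic_sum R (near_count k.+1).
  by rewrite nS /harmonic_sum big_ord_recr.
by case: (correct k) cS => cS; do 2!apply: wp_do => /=; split;
  rewrite //= ?i0 ?r1 ?r2 ?r3 ?r4 ?natr1 ?div1r ?hS ?cS // nS.
Qed.

Definition output_value (j : 'I_N) : R :=
  if is_near j then tknn_value R C (near_count N) (correct_count N) (correct j)
  else 0.

Record output_inv (k : nat) (s : mstate R) : Prop := OutputInv {
  output_i0 : ireg s 0 = k;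
  output_i1 : ireg s 1 = N;
  output_r0 : rreg s 0 = tau;
  output_r1 : rreg s 1 = 1;
  output_r2 : rreg s 2 = (near_count N)%:R;
  output_r3 : rreg s 3 = harmonic_sum R (near_count N) - 1;
  output_r4 : rreg s 4 = (correct_count N)%:R;
  output_r7 : rreg s 7 = C%:R^-1;
  output_memory : forall j : 'I_N, (j < k)%N -> memory s j = output_value j
}.

Lemma output_bodyP (k : 'I_N) s :
  output_inv k s -> wp output_body (output_inv k.+1) s.
Proof.
move=> [i0 i1 r0 r1 r2 r3 r4 r7 mem].
have memS x (j : 'I_N) : x = output_value k -> (j < k.+1)%N ->
    (if j == k :> nat then x else memory s j) = output_value j.
  move=> xk; rewrite ltnS leq_eqVlt; case: eqP => [/val_inj -> //|_ /=]; exact: mem.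
apply: wp_seq; apply: (@wp_dist _ _ _ _ _ _ _ _ _ k); first exact: i0.
apply: wp_seq.
apply: (@wp_if _ _ _ _ _ _ _ _ (is_near k)); first by rewrite /= r0.
have ov : output_value k = if is_near k then
  tknn_value R C (near_count N) (correct_count N) (correct k) else 0 by [].
have [neark|fark] := boolP (is_near k); last first.
  apply: wp_do => /=; apply: wp_seq; do 2!apply: wp_do => /=.
  split; rewrite //= ?i0 // => j; apply: memS.
  by rewrite ov (negPf fark).
(* Point [k] is itself among the neighbours counted. *)
have m0 : (near_count N)%:R != 0 :> R.
  by rewrite pnatr_eq0 /near_count (bigD1 k) //= neark.
rewrite neark in ov.
apply: wp_seq; apply: (@wp_label _ _ _ _ _ _ _ _ k); first exact: i0.
(* Folding the label into the constant avoids running the rest of the body twice. *)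
have -> : (if correct k then Do (RConst 6 1) else Do (RConst 6 0)) =
    Do (RConst 6 (correct k)) by case: (correct k).
apply: wp_do => /=.
apply: wp_seq; apply: wp_do => /=.
apply: wp_seq; apply: wp_div => /=; first by rewrite r2.
apply: wp_seq; apply: wp_do => /=.
apply: wp_seq; apply: wp_do => /=.
apply: wp_seq.
apply: (@wp_if _ _ _ _ _ _ _ _ (near_count N <= 1)%N).
  by rewrite /= r1 r2 (ler_nat _ _ 1).
have [le1|gt1] := leqP (near_count N) 1.
  apply: wp_do => /=; apply: wp_do => /=.
  apply: wp_seq; do 2!apply: wp_do => /=.
  split; rewrite //= ?i0 // => j; apply: memS.
  by rewrite ov /tknn_value le1 r2 r7.
have m1 : (near_count N)%:R - 1 != 0 :> R.
  by rewrite subr_eq0 (eqr_nat _ _ 1) gtn_eqF.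
apply: wp_seq; apply: wp_div => /=; first by rewrite r1 r2.
apply: wp_seq; apply: wp_do => /=.
apply: wp_seq; apply: wp_do => /=.
apply: wp_div => /=; first by rewrite r2.
apply: wp_do => /=; apply: wp_seq; do 2!apply: wp_do => /=.
split; rewrite //= ?i0 // => j; apply: memS.
by rewrite ov /tknn_value leqNgt gt1 /= r1 r2 r3 r4 r7.
Qed.

Lemma tknn_progP :
  wp tknn_prog (fun s => forall j : 'I_N, memory s j = output_value j)
    (mstate0 R).
Proof.
(* The label of [zval] inhabits ['I_C], so computing [1/C] never gets stuck. *)
have C0 : C%:R != 0 :> R.
  by rewrite pnatr_eq0 -lt0n; apply: leq_ltn_trans (ltn_ord zval.2).
do 3!(apply: wp_seq; apply: wp_do => /=).
apply: wp_seq; apply: (wp_for (Inv := count_inv)).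
- by move=> k s [].
- exact: count_bodyP.
- move=> s [i0 i1 r0 r1 r2 r3 r4].
  apply: wp_seq; apply: wp_do => /=; apply: wp_seq; apply: wp_do => /=.
  apply: wp_seq; apply: wp_div => //=; apply: wp_seq; apply: wp_do => /=.
  apply: (wp_for (Inv := output_inv)).
  + by move=> k s' [].
  + exact: output_bodyP.
  + by move=> s' [_ _ _ _ _ _ _ _ mem] j; apply: mem.
  + by split; rewrite //= ?r1 ?r3 ?div1r.
- by split => //=; rewrite /near_count /correct_count ?big_pred0 // /harmonic_sum
    big_ord0.
Qed.

(** The total includes [i] itself, hence the successor; one precomputed count thus serves every
    neighbour. *)
Lemma near_countE (i : 'I_N) : is_near i ->
  near_count N = #|NB z tau zval [set~ i]|.+1.
Proof.
move=> neari; have -> : near_count N = (\sum_j is_near j)%N.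
  by apply: eq_bigl => j; rewrite ltn_ord.
rewrite (bigD1 i) //= neari add1n; congr _.+1.
rewrite -sum1_card big_mkcond [RHS]big_mkcond; apply: eq_bigr => j _.
by rewrite !inE; case: eqP => //= _; case: is_near.
Qed.

Lemma correct_countE (i : 'I_N) : is_near i ->
  correct_count N =
  (correct i + \sum_(j in NB z tau zval [set~ i]) correct j)%N.
Proof.
move=> neari; have -> : correct_count N = (\sum_j (is_near j && correct j))%N.
  by apply: eq_bigl => j; rewrite ltn_ord.
rewrite (bigD1 i) //= neari; congr (_ + _)%N.
rewrite big_mkcond [RHS]big_mkcond; apply: eq_bigr => j _.
by rewrite !inE -/(is_near j); case: eqP => //= _; case: ifP.
Qed.

Lemma output_valueE (i : 'I_N) : output_value i = shapley (tknn z tau zval) i.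
Proof.
rewrite /output_value; have [neari|fari] := boolP (is_near i).
  by rewrite shapley_near //= (near_countE neari) (correct_countE neari).
by rewrite shapley_far.
Qed.

End Correctness.

(** * The formula in terms of [A1] and [A2], and the theorem *)

Lemma tknn_formula (R : realType) (X : metricType R) (C N : nat)
    (z : 'I_N -> X * 'I_C) (zval : X * 'I_C) (tau : R) (i : 'I_N) :
  mdist (z i).1 zval.1 <= tau ->
  shapley (tknn z tau zval) i =
    (2 <= c_tau z tau zval i)%N%:R * (A1 z tau zval i * A2 z tau zval i)
    + (((z i).2 == zval.2)%:R - C%:R^-1) / (c_tau z tau zval i)%:R.
Proof.
move=> neari; rewrite shapley_near //= /tknn_value /A1.
(* This is [harmonic_sum_bin] for [c + 1] points, where [c_tau <= c + 1]. *)
have -> : A2 z tau zval i = harmonic_sum R (c_tau z tau zval i) - 1.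
  rewrite /A2 big_mkord harmonic_sum_bin // /c_tau add1n ltnS /c_others.
  by apply: subset_leq_card; apply/fintype.subsetP => j; rewrite inE => /andP[].
rewrite natrD [_ + _ - (correct z zval i)%:R]addrAC subrr add0r /c_tau add1n.
rewrite -/(correct z zval i).
set b := #|_|; congr (_ + _).
have [b0|b0] := posnP b; first by rewrite b0 mul0r.
have -> : (b.+1 <= 1)%N = false by rewrite ltnS leqNgt b0.
rewrite ltnS b0 mul1r -/(c_plus z tau zval i).
have bn : b%:R != 0 :> R by rewrite pnatr_eq0 -lt0n.
rewrite -[b.+1%:R]natr1 addrK; field.
by rewrite bn natr1 pnatr_eq0.
Qed.

Theorem theorem13 (R : realType) :
  (forall (X : metricType R) (C N : nat) (z : 'I_N -> X * 'I_C)
          (zval : X * 'I_C) (tau : R) (i : 'I_N),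
     shapley (tknn z tau zval) i =
       if mdist (z i).1 zval.1 <= tau then
         (2 <= c_tau z tau zval i)%N%:R * (A1 z tau zval i * A2 z tau zval i)
         + (((z i).2 == zval.2)%:R - C%:R^-1) / (c_tau z tau zval i)%:R
       else 0)
  /\
  (exists (p : prog) (K : nat),
     forall (X : metricType R) (C N : nat) (z : 'I_N -> X * 'I_C)
            (zval : X * 'I_C) (tau : R),
       (0 < N)%N ->
       computes_within z tau zval p (K * N) (shapley (tknn z tau zval)))
  /\
  (forall (X : metricType R) (C N : nat) (z : 'I_N -> X * 'I_C)
          (tau : R) (Dval : seq (X * 'I_C)) (i : 'I_N),
     shapley (tknn_full z tau Dval) i =
       \sum_(zval <- Dval) shapley (tknn z tau zval) i).

Proof.
split; [|split] => [X C N z zval tau i| |X C N z tau Dval i].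
- case: ifPn => [|far]; first exact: tknn_formula.
  exact: shapley_far.
(* The loops are not nested, so [cost N] is affine in [N], and for [N > 0] it is at most [N] times
   its value at 1. *)
- exists tknn_prog, (cost 1 tknn_prog) => X C N z zval tau N0.
  have [t [s [ex le_t mem]]] := tknn_progP z tau zval.
  exists t, s; split => // [|i]; last by rewrite mem output_valueE.
  by apply: leq_trans le_t _ => /=; lia.
(* Linearity: the weights do not depend on the utility. *)
- rewrite shapleyE; under [RHS]eq_bigr do rewrite shapleyE.
  rewrite exchange_big; apply: eq_bigr => S _ /=.
  by rewrite /tknn_full -sumrB mulr_sumr.
Qed.
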